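(* Let $D$ be a square-free integer other than $1$, let $K=\mathbb{Q}(\sqrt D)$ with ring of integers $\mathcal{O}_K$, and let $\delta=2$ if $D\equiv 1 \pmod 4$ and $\delta=1$ otherwise. Suppose $q$ is an odd prime such that $q\nmid D$ and $D\equiv n^2 \pmod q$ for some integer $n$. Then $n^2-D=lq$ for some $l\in\mathbb{Z}$, and, writing $\mathcal P=(q,n+\sqrt D)$ for the ideal of $\mathcal{O}_K$ generated by $q$ and $n+\sqrt D$ and $f(x,y)=lx^2+2nxy+qy^2$: (i) if $D<0$, then $\mathcal P$ is a principal ideal if and only if there exist integers $x,y$ with $f(x,y)=\delta^2$; (ii) if $D>0$, then $\mathcal P$ is a principal ideal if and only if there exist integers $x,y$ with $f(x,y)=\delta^2$ or $f(x,y)=-\delta^2$.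
   Context: A binary quadratic form $f$ with integer coefficients represents an integer $m$ if $f(x,y)=m$ for some integers $x,y$. The ideal $(q,n+\sqrt D)$ is a prime ideal of $\mathcal{O}_K$ lying over $q$. *)

(* Defs.v *)
From HB Require Import structures.
From mathcomp Require Import all_boot all_order all_algebra all_field.
From mathcomp Require Import boolp classical_sets.

Set Implicit Arguments.
Unset Strict Implicit.
Unset Printing Implicit Defensive.

Import Order.TTheory GRing.Theory Num.Theory.
Local Open Scope ring_scope.

Definition square_free (D : int) : Prop :=
  forall m : int, (m ^+ 2 %| D)%Z -> m \is a GRing.unit.

Section RingOfIntegers.
Variable K : fieldExtType rat.

Definition is_integral (x : K) : Prop := integralOver (intr : int -> K) x.

(* A boolean version of is_integral, obtained classically, so that the subtype
   of integral elements inherits the ring structure of K. *)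
Definition integral_pred : {pred K} := fun x => `[< is_integral x >].

Fact integral_subring : subring_closed integral_pred.
Proof.
split=> [|x y /asboolP xi /asboolP yi|x y /asboolP xi /asboolP yi];
  apply/asboolP; first exact: integral1.
- exact: integral_sub.
- exact: integral_mul.
Qed.

HB.instance Definition _ :=
  GRing.isSubringClosed.Build K integral_pred integral_subring.

Record ring_of_integers : Type :=
  RingOfIntegers { roi_val :> K; roi_valP : roi_val \in integral_pred }.

HB.instance Definition _ := [isSub for roi_val].
HB.instance Definition _ := [Choice of ring_of_integers by <:].
HB.instance Definition _ := [SubChoice_isSubComNzRing of ring_of_integers by <:].

Fact integral_sqrt (D : int) (s : K) : s ^+ 2 = D%:~R -> s \in integral_pred.
Proof.
move=> sD; apply/asboolP; exists ('X^2 - D%:P); first exact: monicXnsubC.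
by rewrite /root rmorphB /= map_polyXn map_polyC /= !hornerE sD subrr.
Qed.

Definition sqrt_int (D : int) (s : K) (sD : s ^+ 2 = D%:~R) : ring_of_integers :=
  RingOfIntegers (integral_sqrt sD).

End RingOfIntegers.

Definition ideal_gen (R : comNzRingType) (s : seq R) : set R :=
  [set z | exists c : 'I_(size s) -> R, z = \sum_(i < size s) c i * s`_i].

Definition principal_ideal (R : comNzRingType) (I : set R) : Prop :=
  exists g : R, I = ideal_gen [:: g].

(* When n ^+ 2 - D = l * q, q * qform l n q x y is the norm
   (q * y + n * x) ^+ 2 - D * x ^+ 2 of q * y + (n + sqrt D) * x. *)
Definition qform (l n q x y : int) : int :=
  l * x ^+ 2 + 2 * n * x * y + q * y ^+ 2.

(* %% is the least non-negative residue, so D = -3 falls in the first case. *)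
Definition qdelta (D : int) : int := if (D == 1 %[mod 4])%Z then 2 else 1.

(* Main.v *)
(* If g generates P, its norm N(g) is divisible by q, because
   (n + sqrt D)(n - sqrt D) = l q, and divides N(q) = q^2.  If N(g) were +-q^2,
   then (g) = (q), so q would divide the trace 2 n of n + sqrt D, contrary to
   q not dividing D; hence N(g) = +-q.  Writing
   delta g = q y + (n + sqrt D) x and dividing the norms by q gives
   f(x, y) = +-delta^2.  Conversely, such a representation defines
   g = (q y + (n + sqrt D) x) / delta, and the two quotients q / g and
   (n + sqrt D) / g have integral trace and norm. *)

Require Import Defs.
From HB Require Import structures.
From mathcomp Require Import all_boot all_order all_algebra all_field.
From mathcomp Require Import ring lra zify.
From mathcomp Require Import boolp classical_sets.

Set Implicit Arguments.
Unset Strict Implicit.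
Unset Printing Implicit Defensive.

Import Order.TTheory GRing.Theory Num.Theory.
Local Open Scope ring_scope.

(* With c = 1, it says that the square root of an integer is not a proper
   fraction; with c = D, it bounds the denominators of integral elements. *)
Lemma mul_sqr_rat_int (c m : int) (r : rat) :
  square_free c -> c%:~R * r ^+ 2 = m%:~R -> exists k : int, r = k%:~R.
Proof.
move=> c_sqfree; case: (ratP r) => a b cop_ab eq_m.
have eqZ : c * a ^+ 2 = m * (b.+1%:Z) ^+ 2.
  apply: (@intr_inj rat); rewrite [LHS]intrM [RHS]intrM !rmorphXn /= -eq_m.
  by field; rewrite addrC natr1 pnatr_eq0.
have : (b.+1%:Z ^+ 2 %| c * a ^+ 2)%Z by rewrite eqZ dvdz_mull.
(* The squared denominator is coprime to [a ^+ 2], so it divides [c]; square-freeness then makes the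
   denominator a unit. *)
rewrite Gauss_dvdzl; last first.
  by rewrite coprimezXl // coprimezXr // /coprimez gcdzC.
by move=> /c_sqfree /orP[] // /eqP[->]; exists a; rewrite divr1.
Qed.

(** * Ideals with one or two generators *)

Lemma ideal_gen1P (R : comNzRingType) (a z : R) :
  ideal_gen [:: a] z <-> exists c, z = c * a.
Proof.
split=> [[c ->]|[c ->]]; first by exists (c ord0); rewrite big_ord1.
by exists (fun=> c); rewrite big_ord1.
Qed.

Lemma ideal_gen2P (R : comNzRingType) (a b z : R) :
  ideal_gen [:: a; b] z <-> exists c d, z = c * a + d * b.
Proof.
split=> [[c ->]|[c [d ->]]].
  by exists (c ord0), (c (lift ord0 ord0)); rewrite big_ord_recl big_ord1.
exists (fun i => if i == ord0 then c else d).
by rewrite big_ord_recl big_ord1.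
Qed.

(** Replaces an equality of ideals by equations between elements: [g] divides both generators and is
    a combination of them. *)
Lemma principal_gen2P (R : comNzRingType) (a b : R) :
  principal_ideal (ideal_gen [:: a; b]) <->
  exists g h k c d, [/\ a = h * g, b = k * g & g = c * a + d * b].
Proof.
split=> [[g Ig]|[g [h [k [c [d [aE bE gE]]]]]]].
  have /ideal_gen1P[h aE] : ideal_gen [:: g] a.
    by rewrite -Ig; apply/ideal_gen2P; exists 1, 0; ring.
  have /ideal_gen1P[k bE] : ideal_gen [:: g] b.
    by rewrite -Ig; apply/ideal_gen2P; exists 0, 1; ring.
  have : ideal_gen [:: g] g by apply/ideal_gen1P; exists 1; ring.
  by rewrite -Ig => /ideal_gen2P[c [d gE]]; exists g, h, k, c, d.
exists g; rewrite predeqE => z; split=> [/ideal_gen2P|/ideal_gen1P].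
  move=> [u [v ->]]; apply/ideal_gen1P; exists (u * h + v * k).
  by rewrite {1}aE {1}bE; ring.
move=> [u ->]; apply/ideal_gen2P; exists (u * c), (u * d).
by rewrite gE; ring.
Qed.

(** * Conjugation on the quadratic field *)

Section Conjugation.
Variables (D : int) (K : fieldExtType rat) (s : K).
Hypothesis sD : s ^+ 2 = D%:~R.

(* The nontrivial automorphism of K, as a relation; that it is functional is
   conjugates_uniq. *)
Definition conjugates (x y : K) : Prop :=
  exists u v : rat, x = u%:A + v%:A * s /\ y = u%:A - v%:A * s.

Lemma in_alg_int (m : int) : (m%:~R : rat)%:A = m%:~R :> K.
Proof. exact: (rmorph_int (in_alg K)). Qed.

Lemma in_algM (a b : rat) : (a * b)%:A = a%:A * b%:A :> K.
Proof. exact: (rmorphM (in_alg K)). Qed.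

Lemma conjugates_rat (r : rat) : conjugates r%:A r%:A.
Proof. by exists r, 0; rewrite scale0r mul0r addr0 subr0. Qed.

Lemma conjugates_int (m : int) : conjugates m%:~R m%:~R.
Proof. by rewrite -in_alg_int; apply: conjugates_rat. Qed.

Lemma conjugates_sqrt : conjugates s (- s).
Proof. by exists 0, 1; rewrite !scale0r scale1r mul1r !add0r. Qed.

Lemma conjugatesD x x' y y' :
  conjugates x x' -> conjugates y y' -> conjugates (x + y) (x' + y').
Proof.
move=> [u [v [-> ->]]] [w [z [-> ->]]]; exists (u + w), (v + z).
by rewrite !scalerDl; split; ring.
Qed.

Lemma conjugatesM x x' y y' :
  conjugates x x' -> conjugates y y' -> conjugates (x * y) (x' * y').
Proof.
move=> [u [v [-> ->]]] [w [z [-> ->]]].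
exists (u * w + v * z * D%:~R), (u * z + v * w).
by rewrite !scalerDl !in_algM in_alg_int -sD; split; ring.
Qed.

Lemma conjugatesN x x' : conjugates x x' -> conjugates (- x) (- x').
Proof.
by move=> /(conjugatesM (conjugates_int (- 1))); rewrite rmorphN !mulN1r.
Qed.

(** Conjugation respects sums and products and fixes the rationals, hence commutes with rational
    polynomials. *)
Lemma conjugates_horner (p : {poly rat}) x y : conjugates x y ->
  conjugates (map_poly (in_alg K) p).[x] (map_poly (in_alg K) p).[y].
Proof.
move=> xy; elim/poly_ind: p => [|p c IHp].
  by rewrite rmorph0 !horner0; apply: conjugates_int 0.
rewrite rmorphD rmorphM /= map_polyX map_polyC /= !hornerE.
exact: conjugatesD (conjugatesM IHp xy) (conjugates_rat c).
Qed.

(** The embedding of the rationals into [K] is injective, so the monic integer polynomial already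
    vanishes at [r]; in [algC], a rational algebraic integer is an integer. *)
Lemma in_alg_integral_int (r : rat) :
  is_integral (r%:A : K) -> exists m : int, r = m%:~R.
Proof.
case=> p p_monic /eqP pr0.
have {}pr0 : root (map_poly intr p) r.
  rewrite -(fmorph_root (in_alg K)) -map_poly_comp /root.
  by apply/eqP; rewrite -[RHS]pr0; congr _.[_]; apply: eq_map_poly => m;
     rewrite /= in_alg_int.
have /Cint_rat_Aint : (ratr r : algC) \in Crat by apply: Crat_rat.
have rA : (ratr r : algC) \in Aint.
  apply: (@root_monic_Aint (map_poly intr p)).
  - have := fmorph_root (ratr : rat -> algC) (map_poly intr p) r.
    rewrite pr0 -map_poly_comp /is_true => <-.
    by congr root; apply: eq_map_poly => m; rewrite /= ratr_int.
  - by apply: monic_map.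
  - by apply/polyOverP => i; rewrite coef_map /= intr_int.
move=> /(_ rA) /intrP[m mE]; exists m.
by apply: (fmorph_inj (ratr : rat -> algC)); rewrite /= mE ratr_int.
Qed.

Hypothesis D_sqfree : square_free D.
Hypothesis D_neq1 : D <> 1.
Hypothesis K_gen : <<1; s>>%VS = {:K}%VS.

(** Any [x] is a rational polynomial in [s]; evaluating that polynomial at [- s] gives a
    conjugate. *)
Lemma conjugates_exists x : exists y, conjugates x y.
Proof.
have : x \in <<1; s>>%VS by rewrite K_gen memvf.
move=> /Fadjoin_poly_eq <-.
have /polyOver1P[p ->] := Fadjoin_polyOver 1%VS s x.
by exists (map_poly (in_alg K) p).[- s]; apply/conjugates_horner/conjugates_sqrt.
Qed.

Lemma square_rat_neq (r : rat) : r ^+ 2 <> D%:~R.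
Proof.
move=> rD; have sqf1 : square_free 1.
  move=> m; rewrite expr2 => /(dvdz_trans (dvdz_mulr m (dvdzz m))).
  by rewrite dvdz1 => /eqP m1; case: (m) m1 => [[|[]]|[]].
case: (@mul_sqr_rat_int 1 D r) => // [|k rE]; first by rewrite mul1r.
have kD : k ^+ 2 = D by apply: (@intr_inj rat); rewrite rmorphXn /= -rE.
have := @D_sqfree k; rewrite kD => /(_ (dvdzz D)) k1; apply: D_neq1; rewrite -kD.
by case/orP: k1 => /eqP ->.
Qed.

(** A relation [u + v s = 0] with [v] nonzero would make [s] rational, hence [D] the square of a
    rational. *)
Lemma conjugates0 y : conjugates 0 y -> y = 0.
Proof.
move=> [u [v [/eqP]]]; rewrite eq_sym addr_eq0 => /eqP uE ->.
have [v0|v0] := eqVneq v 0; first by rewrite uE v0 scale0r !mul0r subr0 oppr0.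
have vA0 : v%:A != 0 :> K by rewrite (fmorph_eq0 (in_alg K)).
have wE : (u / v)%:A = - s :> K.
  by apply: (mulIf vA0); rewrite -in_algM divfK // uE mulNr mulrC.
case: (@square_rat_neq (u / v)).
by apply: (fmorph_inj (in_alg K)); rewrite /= in_alg_int -sD expr2 in_algM wE
  mulrNN.
Qed.

Lemma conjugates_uniq x y z : conjugates x y -> conjugates x z -> y = z.
Proof.
move=> xy xz; apply/eqP; rewrite -subr_eq0; apply/eqP/conjugates0.
by rewrite -(subrr x); apply/conjugatesD/conjugatesN.
Qed.

(** The same monic polynomial works: its value at [y] is conjugate to its value 0 at [x]. *)
Lemma conjugates_integral x y : conjugates x y -> is_integral x -> is_integral y.
Proof.
move=> xy [p p_monic px]; exists p => //; move: px.
have -> : map_poly intr p = map_poly (in_alg K) (map_poly intr p).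
  by rewrite -map_poly_comp; apply: eq_map_poly => m; rewrite /= in_alg_int.
move=> /eqP px; apply/eqP/conjugates0; rewrite -px.
exact: conjugates_horner.
Qed.

Lemma trace_integral x y :
  conjugates x y -> is_integral x -> exists t : int, x + y = t%:~R.
Proof.
move=> xy xi; have yi := conjugates_integral xy xi.
have := integral_add xi yi.
case: xy => u [v [xE yE]].
have -> : x + y = (u + u)%:A by rewrite xE yE scalerDl; ring.
by case/in_alg_integral_int => t ->; exists t; rewrite in_alg_int.
Qed.

Lemma norm_integral x y :
  conjugates x y -> is_integral x -> exists N : int, x * y = N%:~R.
Proof.
move=> xy xi; have yi := conjugates_integral xy xi.
have := integral_mul xi yi.
case: xy => u [v [xE yE]].
have -> : x * y = (u * u - v * v * D%:~R)%:A.
  by rewrite xE yE scalerBl !in_algM in_alg_int -sD; ring.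
by case/in_alg_integral_int => t ->; exists t; rewrite in_alg_int.
Qed.

(** The quotient [w] is the rational number [N / q], and an integral rational is an integer. *)
Lemma integral_dvdz (q N : int) (w : K) :
  q != 0 -> is_integral w -> q%:~R * w = N%:~R -> (q %| N)%Z.
Proof.
move=> q0 wi wE.
have q0K : q%:~R != 0 :> K.
  by rewrite -in_alg_int (fmorph_eq0 (in_alg K)) intr_eq0.
have ww : w = (N%:~R / q%:~R)%:A.
  apply: (mulfI q0K); rewrite wE -!in_alg_int -(rmorphM (in_alg K)) /=.
  by rewrite mulrC divfK ?intr_eq0.
move: wi; rewrite ww => /in_alg_integral_int[m mE]; apply/dvdzP; exists m.
by apply: (@intr_inj rat); rewrite intrM -mE divfK ?intr_eq0.
Qed.

(** * Conjugates, traces and norms in the ring of integers *)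

Notation O := (ring_of_integers K).

Lemma val_integral (x : O) : is_integral (x : K).
Proof. exact/asboolP/(roi_valP x). Qed.

Lemma roi_val_int (m : int) : roi_val (m%:~R : O) = m%:~R.
Proof. exact: (rmorph_int (val : O -> K)). Qed.

Lemma roi_intr_inj (m p : int) : m%:~R = p%:~R :> O -> m = p.
Proof.
move=> /(congr1 (@roi_val K)); rewrite !roi_val_int -!in_alg_int.
by move=> /(fmorph_inj (in_alg K)); apply: intr_inj.
Qed.

Lemma roi_intr_mulfI (m : int) (x y : O) :
  m != 0 -> m%:~R * x = m%:~R * y -> x = y.
Proof.
move=> m0 /(congr1 (val : O -> K)); rewrite !rmorphM /= roi_val_int => e.
apply/val_inj/(mulfI _ e).
by rewrite -in_alg_int (fmorph_eq0 (in_alg K)) intr_eq0.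
Qed.

Lemma roi_conjugates_exists (x : O) : exists y : O, conjugates x y.
Proof.
have [y xy] := conjugates_exists x.
have yi : y \in @integral_pred K.
  exact/asboolP/(conjugates_integral xy)/val_integral.
by exists (RingOfIntegers yi).
Qed.

Lemma roi_trace (x y : O) : conjugates x y -> exists t : int, x + y = t%:~R.
Proof.
move=> /trace_integral/(_ (val_integral x))[t xyt]; exists t.
by apply: val_inj; rewrite /= roi_val_int.
Qed.

Lemma roi_norm (x y : O) : conjugates x y -> exists N : int, x * y = N%:~R.
Proof.
move=> /norm_integral/(_ (val_integral x))[N xyN]; exists N.
by apply: val_inj; rewrite /= roi_val_int.
Qed.

Lemma roi_dvdz (q N : int) (w : O) :
  q != 0 -> q%:~R * w = N%:~R -> (q %| N)%Z.
Proof.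
move=> q0 /(congr1 (val : O -> K)); rewrite rmorphM /= !roi_val_int.
exact: integral_dvdz q0 (val_integral w).
Qed.

Lemma conjugates_roi_uniq (x y z : O) :
  conjugates x y -> conjugates x z -> y = z.
Proof. by move=> xy xz; apply/val_inj/(conjugates_uniq xy xz). Qed.

Lemma roi_conjugates_int (m : int) : conjugates (m%:~R : O) (m%:~R : O).
Proof. by rewrite roi_val_int; apply: conjugates_int. Qed.

(** * Coordinates of integral elements, with denominator [qdelta D] *)

Lemma qdelta_dvd2 : exists e : int, qdelta D * e = 2.
Proof. by rewrite /qdelta; case: eqP => _; [exists 1 | exists 2]. Qed.

(** Square-freeness leaves [D] congruent to 2 or 3 modulo 4; squares being 0 or 1 modulo 4, the left
    side then vanishes modulo 4 only for even [t] and [w]. *)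
Lemma even_of_norm_mod4 (t w N : int) : (D != 1 %[mod 4])%Z ->
  t ^+ 2 - D * w ^+ 2 = 4 * N -> exists a b : int, t = 2 * a /\ w = 2 * b.
Proof.
move=> D1 e; have D0 : (D %% 4)%Z != 0.
  by apply/negP => /eqP/dvdz_mod0P; move/(@D_sqfree 2).
exists (t %/ 2)%Z, (w %/ 2)%Z.
have := divz_eq t 2; have := divz_eq w 2; have := divz_eq D 4.
have := modz_ge0 t (isT : 2 != 0 :> int); have := modz_ge0 w (isT : 2 != 0 :> int).
have := ltz_pmod t (isT : 0 < 2 :> int); have := ltz_pmod w (isT : 0 < 2 :> int).
have := modz_ge0 D (isT : 4 != 0 :> int); have := ltz_pmod D (isT : 0 < 4 :> int).
move: D1 D0 e; rewrite (modz_small (_ : 0 <= 1 < `|4|)) //.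
move: (t %/ 2)%Z (t %% 2)%Z (w %/ 2)%Z (w %% 2)%Z (D %/ 4)%Z (D %% 4)%Z.
move=> a i b j k r r1 r0 e.
move=> r4 r_ge0 j2 i2 j_ge0 i_ge0 DE wE tE.
have {}r0 : r = 2 \/ r = 3 by lia.
have {}j2 : j = 0 \/ j = 1 by lia.
have {}i2 : i = 0 \/ i = 1 by lia.
move: e; rewrite tE wE DE {tE wE DE}.
by case: r0 => ->; case: j2 => ->; case: i2 => ->; lia.
Qed.

Lemma roi_coordinates (x y : O) : conjugates x y -> exists a b : int,
  (qdelta D)%:~R * x = a%:~R + b%:~R * sqrt_int sD /\
  (qdelta D)%:~R * y = a%:~R - b%:~R * sqrt_int sD.
Proof.
move=> xy; have [t tE] := roi_trace xy; have [N NE] := roi_norm xy.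
case: (xy) => u [v [xE yE]].
have ut : u + u = t%:~R.
  apply: (fmorph_inj (in_alg K)); rewrite /= in_alg_int -roi_val_int -tE /=.
  by rewrite xE yE scalerDl; ring.
have uvN : u * u - v * v * D%:~R = N%:~R.
  apply: (fmorph_inj (in_alg K)); rewrite /= in_alg_int -roi_val_int -NE /=.
  by rewrite xE yE scalerBl !in_algM in_alg_int -sD; ring.
(* D (2 v)^2 = t^2 - 4 N is an integer, hence so is 2 v *)
have [w wE] : exists w : int, v + v = w%:~R.
  apply: (@mul_sqr_rat_int D (t ^+ 2 - 4 * N)) => //.
  by rewrite intrB rmorphXn intrM /= -ut -uvN; ring.
have twN : t ^+ 2 - D * w ^+ 2 = 4 * N.
  apply: (@intr_inj rat); rewrite intrB rmorphXn [(_ * w ^+ 2)%:~R]intrM rmorphXn.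
  by rewrite intrM /= -ut -wE -uvN; ring.
suff [a [b [aE bE]]] : exists a b : int,
    (qdelta D)%:~R * u = a%:~R /\ (qdelta D)%:~R * v = b%:~R.
  exists a, b; split; apply: val_inj;
    rewrite /= !roi_val_int ?xE ?yE -!in_alg_int -aE -bE !in_algM; ring.
(* If [D] is 1 modulo 4, the coordinates are [t = 2 u] and [w = 2 v] themselves; otherwise [t] and
   [w] are even and their halves serve. *)
rewrite /qdelta; case: ifPn => D4.
  by exists t, w; rewrite -ut -wE; split; ring.
have [a [b [ta wb]]] := even_of_norm_mod4 D4 twN.
exists a, b; move: ut wE; rewrite ta wb !intrM; split; lra.
Qed.

(** A converse to [roi_coordinates]: the norm of [x] is the integer [N], and [m] dividing 2 makes
    the trace an integer too. *)
Lemma quadratic_integral (a b e m N : int) (x : K) : m * e = 2 ->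
  a ^+ 2 - D * b ^+ 2 = m ^+ 2 * N ->
  m%:~R * x = a%:~R + b%:~R * s -> x \in @integral_pred K.
Proof.
move=> me abN xE; apply/asboolP.
(* X^2 - tr(x) X + N(x), with trace 2 a / m = e a *)
exists ('X * ('X - (e * a)%:P) + N%:P).
  rewrite monicE lead_coefDl -?monicE ?rpredM ?monicX ?monicXsubC //.
  rewrite size_monicM ?monicX -?size_poly_eq0 ?size_XsubC // size_polyX /=.
  by rewrite (leq_ltn_trans (size_polyC_leq1 _)).
rewrite /root rmorphD rmorphM rmorphB /= map_polyX !map_polyC /= !hornerE.
have m0 : m%:~R != 0 :> K.
  rewrite -in_alg_int (fmorph_eq0 (in_alg K)) intr_eq0.
  by apply: contra_eq_neq me => ->; rewrite mul0r.
apply/eqP/(mulfI m0)/(mulfI m0); rewrite !mulr0.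
have {}abN : a%:~R ^+ 2 - s ^+ 2 * b%:~R ^+ 2 = m%:~R ^+ 2 * N%:~R :> K.
  by rewrite sD -!rmorphXn -!intrM -intrB /= abN.
have {}me : m%:~R * e%:~R = 2 :> K by rewrite -intrM me.
have -> : m%:~R * (m%:~R * (x * (x - (e * a)%:~R) + N%:~R)) =
  (m%:~R * x) ^+ 2 - (m%:~R * e%:~R) * a%:~R * (m%:~R * x)
   + m%:~R ^+ 2 * N%:~R by rewrite intrM; ring.
by rewrite -abN me xE; ring.
Qed.

(** * Norms of elements of the ideal generated by [q] and [n + S] *)

Section PrimeIdeal.
Variables (q : nat) (n l : int).
Hypothesis q_prime : prime q.
Hypothesis q_odd : odd q.
Hypothesis qND : ~~ (q%:Z %| D)%Z.
Hypothesis nDlq : n ^+ 2 - D = l * q%:Z.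

Notation S := (sqrt_int sD : O).
Notation qO := ((q%:Z)%:~R : O).
Notation delta := (qdelta D).

Lemma roi_sqrt_sqr : S ^+ 2 = D%:~R.
Proof. by apply: val_inj; rewrite rmorphXn /= sD roi_val_int. Qed.

Lemma roi_norm_gen : (n%:~R + S) * (n%:~R - S) = l%:~R * qO.
Proof.
by rewrite mulrC -subr_sqr roi_sqrt_sqr -rmorphXn -intrB nDlq intrM.
Qed.

Lemma roi_conjugatesD (x x' y y' : O) :
  conjugates x x' -> conjugates y y' -> conjugates (x + y : O) (x' + y' : O).
Proof. exact: conjugatesD. Qed.

Lemma roi_conjugatesM (x x' y y' : O) :
  conjugates x x' -> conjugates y y' -> conjugates (x * y : O) (x' * y' : O).
Proof. exact: conjugatesM. Qed.

Lemma conjugates_gen : conjugates (n%:~R + S : O) (n%:~R - S : O).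
Proof.
apply: roi_conjugatesD; first exact: roi_conjugates_int.
exact: conjugates_sqrt.
Qed.

Lemma qZ_neq0 : q%:Z != 0.
Proof. by rewrite eqz_nat -lt0n prime_gt0. Qed.

(** In the expansion of [x x'] each term carries a factor [q], the last one because
    [(n + S) (n - S) = l q]. *)
Lemma prime_ideal_norm_dvdz (c d x x' : O) (N : int) :
  x = c * qO + d * (n%:~R + S) -> conjugates x x' -> x * x' = N%:~R ->
  (q%:Z %| N)%Z.
Proof.
move=> xE xx' xxN.
have [c' cc'] := roi_conjugates_exists c.
have [d' dd'] := roi_conjugates_exists d.
have x'E : x' = c' * qO + d' * (n%:~R - S).
  apply: conjugates_roi_uniq xx' _; rewrite xE.
  apply: roi_conjugatesD; apply: roi_conjugatesM => //.
    exact: roi_conjugates_int.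
  exact: conjugates_gen.
apply: (@roi_dvdz _ _ (qO * c * c' + c * d' * (n%:~R - S)
  + c' * d * (n%:~R + S) + d * d' * l%:~R) qZ_neq0).
rewrite -xxN xE x'E.
transitivity (qO ^+ 2 * c * c' + qO * c * d' * (n%:~R - S)
  + qO * c' * d * (n%:~R + S) + d * d' * (l%:~R * qO)); first by ring.
by rewrite -roi_norm_gen; ring.
Qed.

Lemma qNdvdn : ~~ (q%:Z %| n)%Z.
Proof.
apply: contra qND => qn; rewrite (_ : D = n ^+ 2 - l * q%:Z); last first.
  by rewrite -nDlq; ring.
by rewrite rpredB // ?dvdz_mull // expr2 dvdz_mull.
Qed.

Lemma gen_norm (g g' h k c d : O) (N : int) :
  qO = h * g -> n%:~R + S = k * g -> g = c * qO + d * (n%:~R + S) ->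
  conjugates g g' -> g * g' = N%:~R -> N = q%:Z \/ N = - q%:Z.
Proof.
move=> qE nE gE gg' NE.
have [h' hh'] := roi_conjugates_exists h.
have [k' kk'] := roi_conjugates_exists k.
have [N' N'E] := roi_norm hh'.
have qE' : qO = h' * g'.
  apply: conjugates_roi_uniq (roi_conjugates_int q) _.
  by rewrite qE; apply: roi_conjugatesM.
have nE' : n%:~R - S = k' * g'.
  apply: conjugates_roi_uniq conjugates_gen _.
  by rewrite nE; apply: roi_conjugatesM.
have NN' : N * N' = q%:Z * q%:Z.
  apply: roi_intr_inj; rewrite !intrM -NE -N'E {1}qE qE'; ring.
have /dvdzP[m mE] := prime_ideal_norm_dvdz gE gg' NE.
have mN' : m * N' = q%:Z.
  by apply: (mulIf qZ_neq0); rewrite -NN' mE; ring.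
have : `|m|%N \in [:: 1%N; q].
  have := q_prime; rewrite !inE => /primeP[_]; apply.
  by rewrite -[q]/`|q%:Z|%N -mN' abszM dvdn_mulr.
(* Since [N = m q], a unit [m] gives the claim; the case of [m] equal to [q] up to sign is refuted
   below. *)
rewrite !inE => /orP[] /eqP m1; first by rewrite mE; case: m m1 {mE mN'}; lia.
have N'1 : N' * N' = 1.
  have N'n : `|N'|%N = 1%N.
    apply/eqP; rewrite -(eqn_pmul2l (prime_gt0 q_prime)) muln1.
    by rewrite -{1}m1 -abszM mN'.
  by case: (N') N'n => [[|[]]|[]].
have N1 : N'%:~R * N'%:~R = 1 :> O by rewrite -intrM N'1.
(* As [N'] is a sign, [h] is a unit with inverse [N' h'], so [g] and [g'] are both multiples of
   [q]. *)
have gq : g = N'%:~R * h' * qO.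
  transitivity (N'%:~R * (h * h') * g); first by rewrite N'E N1 mul1r.
  by rewrite qE; ring.
have gq' : g' = N'%:~R * h * qO.
  transitivity (N'%:~R * (h * h') * g'); first by rewrite N'E N1 mul1r.
  by rewrite qE'; ring.
(* [2 n] is the trace [k g + k' g'] of [n + S], whose two terms are multiples of [q]. *)
have : (q%:Z %| 2 * n)%Z.
  apply: (@roi_dvdz _ _ (N'%:~R * (k * h' + k' * h)) qZ_neq0).
  transitivity (k * g + k' * g'); first by rewrite gq gq'; ring.
  by rewrite -nE -nE' intrM; ring.
rewrite Gauss_dvdzr ?(negbTE qNdvdn) //.
by rewrite coprimezE /= coprime_sym coprime2n.
Qed.

(** * Generators of the ideal and values of the form *)

Lemma form_norm (x y : int) :
  q%:Z * qform l n q%:Z x y = (q%:Z * y + n * x) ^+ 2 - D * x ^+ 2.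
Proof.
rewrite (_ : D = n ^+ 2 - l * q%:Z) /qform; first by ring.
by rewrite -nDlq; ring.
Qed.

Lemma principal_represents (g h k c d : O) :
  qO = h * g -> n%:~R + S = k * g -> g = c * qO + d * (n%:~R + S) ->
  exists x y : int, qform l n q%:Z x y = delta ^+ 2 \/
                    qform l n q%:Z x y = - delta ^+ 2.
Proof.
move=> qE nE gE; have [g' gg'] := roi_conjugates_exists g.
have [N NE] := roi_norm gg'.
have Nq := gen_norm qE nE gE gg' NE.
have [a [b [ag bg]]] := roi_coordinates gg'.
have abN : a ^+ 2 - D * b ^+ 2 = delta ^+ 2 * N.
  apply: roi_intr_inj; rewrite intrB rmorphXn [(_ * b ^+ 2)%:~R]intrM rmorphXn.
  rewrite -roi_sqrt_sqr [RHS]intrM rmorphXn /= -NE.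
  transitivity ((a%:~R + b%:~R * S) * (a%:~R - b%:~R * S)); first by ring.
  by rewrite -ag -bg; ring.
(* The integer [a - n b] equals [delta g - b (n + S)], so it lies in the ideal; its norm is its
   square. *)
have : (q%:Z %| a - n * b)%Z.
  suff : (q%:Z %| (a - n * b) ^+ 2)%Z.
    by rewrite !dvdzE abszX Euclid_dvdX // andbT.
  apply: (@prime_ideal_norm_dvdz (delta%:~R * c) (delta%:~R * d - b%:~R)
            (a - n * b)%:~R).
  - transitivity (delta%:~R * g - b%:~R * (n%:~R + S)).
      by rewrite ag intrB intrM; ring.
    by rewrite {1}gE; ring.
  - exact: roi_conjugates_int.
  - by rewrite rmorphXn.
case/dvdzP => y yE; exists b, y.
have fE : q%:Z * qform l n q%:Z b y = delta ^+ 2 * N.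
  by rewrite form_norm -abN -(_ : a = q%:Z * y + n * b) // mulrC -yE; ring.
case: Nq fE => -> fE; [left | right]; apply: (mulfI qZ_neq0); rewrite fE; ring.
Qed.

Lemma qdelta_coprime : coprimez delta q%:Z.
Proof.
have [e /(congr1 absz)] := qdelta_dvd2; rewrite abszM => eE.
have : coprime 2 `|q%:Z| by rewrite coprime2n.
by rewrite coprimezE; apply: coprime_dvdl; rewrite -[2%N]eE dvdn_mulr.
Qed.

(** The sign [u] treats both values of the form together; being its own inverse, it also corrects
    the sign of the norm [u q] of [g]. *)
Lemma represents_principal (x y u : int) : u * u = 1 ->
  qform l n q%:Z x y = u * delta ^+ 2 ->
  exists g h k c d : O,
    [/\ qO = h * g, n%:~R + S = k * g & g = c * qO + d * (n%:~R + S)].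
Proof.
move=> uu fE; have [e de] := qdelta_dvd2.
have delta0 : delta != 0 by apply: contra_eq_neq de => ->; rewrite mul0r.
(* An element [a + b S] whose norm is divisible by [delta ^+ 2] is divisible by [delta] among the
   integral elements. *)
have lift_O (a b N : int) : a ^+ 2 - D * b ^+ 2 = delta ^+ 2 * N ->
    exists z : O, delta%:~R * z = a%:~R + b%:~R * S.
  move=> abN; pose z : K := (a%:~R + b%:~R * s) / delta%:~R.
  have zE : delta%:~R * z = a%:~R + b%:~R * s.
    rewrite mulrC divfK //.
    by rewrite -in_alg_int (fmorph_eq0 (in_alg K)) intr_eq0.
  exists (RingOfIntegers (quadratic_integral de abN zE)); apply: val_inj.
  by rewrite /= !roi_val_int.
have normE : (q%:Z * y + n * x) ^+ 2 - D * x ^+ 2 = delta ^+ 2 * (q%:Z * u).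
  by rewrite -form_norm fE; ring.
have [g gE] := lift_O _ _ _ normE.
have [g' g'E] : exists z : O,
    delta%:~R * z = (q%:Z * y + n * x)%:~R + (- x)%:~R * S.
  by apply: (lift_O _ _ (q%:Z * u)); rewrite sqrrN.
(* k is, up to u, (n + S) g' / q, which is where (n y + l x) + y S comes from *)
have [k kE] : exists z : O, delta%:~R * z = (n * y + l * x)%:~R + y%:~R * S.
  apply: (lift_O _ _ (l * u)).
  (* The norm of [(n y + l x) + y S] is [l] times the value of the form. *)
  transitivity (l * qform l n q%:Z x y); last by rewrite fE; ring.
  rewrite (_ : D = n ^+ 2 - l * q%:Z) /qform; first by ring.
  by rewrite -nDlq; ring.
have DE : S ^+ 2 = n%:~R ^+ 2 - l%:~R * qO.
  rewrite roi_sqrt_sqr -rmorphXn -[_ * qO]intrM -intrB -nDlq; congr _%:~R; ring.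
have fO : l%:~R * x%:~R ^+ 2 + 2 * n%:~R * x%:~R * y%:~R + qO * y%:~R ^+ 2
    = u%:~R * delta%:~R ^+ 2 :> O.
  by rewrite -[delta%:~R ^+ 2]rmorphXn -intrM -fE /qform !(intrD, intrM); ring.
have uuO : u%:~R * u%:~R = 1 :> O by rewrite -intrM uu.
(* With [v delta + w q = 1], one has [g = v (delta g) + w g q], and [delta g = q y + (n + S) x]
   yields the coefficients that put [g] in the ideal. *)
have /coprimezP[[v w] /= vw] := qdelta_coprime.
exists g, (u%:~R * g'), (u%:~R * k), (v%:~R * y%:~R + w%:~R * g), (v%:~R * x%:~R).
split.
(* Multiplying by [delta ^+ 2] turns the two factors into [delta g'] and [delta g], whose
   coordinates are known. *)
- apply: (@roi_intr_mulfI delta) => //; apply: (@roi_intr_mulfI delta) => //.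
  transitivity (u%:~R * (delta%:~R * g') * (delta%:~R * g)); last by ring.
  rewrite g'E gE !(intrM, intrD, intrN).
  transitivity (u%:~R * (u%:~R * delta%:~R ^+ 2) * qO).
    by rewrite !mulrA uuO; ring.
  rewrite -fO; transitivity (u%:~R * (qO ^+ 2 * y%:~R ^+ 2
    + 2 * qO * y%:~R * n%:~R * x%:~R + n%:~R ^+ 2 * x%:~R ^+ 2
    - x%:~R ^+ 2 * (n%:~R ^+ 2 - l%:~R * qO))); first by ring.
  by rewrite -DE; ring.
- apply: (@roi_intr_mulfI delta) => //; apply: (@roi_intr_mulfI delta) => //.
  transitivity (u%:~R * (delta%:~R * k) * (delta%:~R * g)); last by ring.
  rewrite kE gE !(intrM, intrD, intrN).
  transitivity (u%:~R * (u%:~R * delta%:~R ^+ 2) * (n%:~R + S)).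
    by rewrite !mulrA uuO; ring.
  rewrite -fO; apply/eqP; rewrite -subr_eq0; apply/eqP.
  transitivity (u%:~R * x%:~R * y%:~R * (n%:~R ^+ 2 - l%:~R * qO - S ^+ 2)).
    by ring.
  by rewrite -DE subrr mulr0.
- transitivity ((v * delta + w * q%:Z)%:~R * g); first by rewrite vw mul1r.
  transitivity (v%:~R * (delta%:~R * g) + w%:~R * g * qO).
    by rewrite intrD !intrM; ring.
  by rewrite gE !(intrM, intrD); ring.
Qed.

End PrimeIdeal.
End Conjugation.

Theorem theorem1p1 (D : int) (D_sqfree : square_free D) (D_neq1 : D <> 1)
    (K : fieldExtType rat) (sqrtD : K) (sqrtDE : sqrtD ^+ 2 = D%:~R)
    (K_gen : <<1; sqrtD>>%VS = {:K}%VS)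
    (q : nat) (q_prime : prime q) (q_odd : odd q) (qND : ~~ (q%:Z %| D)%Z)
    (n : int) (Dn : (D = n ^+ 2 %[mod q%:Z])%Z) :
  exists l : int,
    let P := ideal_gen [:: q%:R; n%:~R + sqrt_int sqrtDE] in
    [/\ n ^+ 2 - D = l * q%:Z,
        D < 0 ->
          (principal_ideal P <->
           exists x y : int, qform l n q%:Z x y = qdelta D ^+ 2)
      & 0 < D ->
          (principal_ideal P <->
           exists x y : int, qform l n q%:Z x y = qdelta D ^+ 2 \/
                             qform l n q%:Z x y = - qdelta D ^+ 2)].
Proof.
have /dvdzP[l lE] : (q%:Z %| n ^+ 2 - D)%Z by rewrite -eqz_mod_dvd Dn.
exists l => P.
have fwd : principal_ideal P ->
    exists x y : int, qform l n q%:Z x y = qdelta D ^+ 2 \/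
                      qform l n q%:Z x y = - qdelta D ^+ 2.
  move=> /principal_gen2P[g [h [k [c [d [qE nE gE]]]]]].
  exact: (principal_represents D_sqfree D_neq1 K_gen q_prime q_odd qND lE qE nE gE).
have bwd u x y : u * u = 1 -> qform l n q%:Z x y = u * qdelta D ^+ 2 ->
    principal_ideal P.
  by move=> uu fE; apply/principal_gen2P; apply: represents_principal uu fE.
split=> // [D0|D0]; split=> [/fwd[x [y fE]]|[x [y fE]]].
- exists x, y; case: fE => // fE.
  (* For negative [D] norms are nonnegative, which excludes the value [- qdelta D ^+ 2] because [q]
     is positive. *)
  have : 0 <= (q%:Z * y + n * x) ^+ 2 - D * x ^+ 2.
    by rewrite subr_ge0 (le_trans _ (sqr_ge0 _)) // mulr_le0_ge0 ?sqr_ge0 ?ltW.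
  rewrite -(form_norm lE) fE mulrN oppr_ge0 leNgt mulr_gt0 ?exprn_gt0 //.
    exact: prime_gt0 q_prime.
  by rewrite /qdelta; case: ifP.
- by apply: (bwd 1 x y); rewrite ?mul1r.
- by exists x, y.
- case: fE => fE; first by apply: (bwd 1 x y); rewrite ?mul1r.
  by apply: (bwd (- 1) x y); rewrite ?mulN1r.
Qed.
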